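(* Let $\mathfrak s$ be a simple Lie algebra, let $\mathfrak g=\mathfrak s\otimes\Bbbk[\xi]\oplus\Bbbk\partial$ be the corresponding Takiff superalgebra, and let $x\in\mathfrak g_{\bar 1}$. Then $x$ is distinguished if and only if $x=\lambda\partial+\xi u$ where $\lambda\in\Bbbk$ and $u$ is a distinguished nilpotent element in $\mathfrak s$.
   Context: Base field $\Bbbk$: algebraically closed of characteristic $0$; Lie algebras are finite-dimensional. Here $\xi$ is an odd variable with $\xi^2=0$, $\Bbbk[\xi]=\Bbbk\oplus\Bbbk\xi$; in $\mathfrak s\otimes\Bbbk[\xi]=\mathfrak s\oplus\xi\mathfrak s$ the odd part $\xi\mathfrak s$ is an abelian ideal isomorphic to the adjoint module; $\partial=\frac{\partial}{\partial\xi}$ is an odd derivation: $[\partial,\xi u]=u$, $[\partial,u]=0$ for $u\in\mathfrak s$, and $[\partial,\partial]=0$. So $\mathfrak g_{\bar 0}=\mathfrak s$ and $\mathfrak g_{\bar 1}=\xi\mathfrak s\oplus\Bbbk\partial$. An element $x\in\mathfrak g_{\bar 1}$ is distinguished if every semisimple element of $\mathfrak g_{\bar 0}$ commuting with $x$ lies in $Z(\mathfrak g)_{\bar 0}$, where $Z(\mathfrak g)$ is the center of $\mathfrak g$. A nilpotent element $u$ of $\mathfrak s$ is distinguished if its centralizer $\mathfrak s^u$ contains no non-zero semisimple element. *)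

(* Defs.v *)
From HB Require Import structures.
From mathcomp Require Import all_boot all_order all_algebra.

Set Implicit Arguments.
Unset Strict Implicit.
Unset Printing Implicit Defensive.

Import GRing.Theory.
Local Open Scope ring_scope.

HB.mixin Record Vector_isLieAlgebra (k : fieldType) L of Vector k L := {
  lie : L -> L -> L;
  lie_linearr : forall x, linear (lie x);
  lie_linearl : forall y, linear (lie^~ y);
  lie_alt : forall x, lie x x = 0;
  lie_jacobi : forall x y z,
    lie x (lie y z) = lie (lie x y) z + lie y (lie x z) }.

#[short(type="lieAlgType")]
HB.structure Definition LieAlgebra (k : fieldType) :=
  { L of Vector k L & Vector_isLieAlgebra k L }.

(* [sgrade false] is the even part and [sgrade true] the odd part.  [slie_alt]
   follows from [slie_skew] unless k has characteristic 2; it makes the even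
   part a Lie algebra over every field. *)
HB.mixin Record Vector_isLieSuperalgebra (k : fieldType) L of Vector k L := {
  sgrade : bool -> {vspace L};
  sgrade_full : (sgrade false + sgrade true = fullv)%VS;
  sgrade_direct : (sgrade false :&: sgrade true = 0)%VS;
  slie : L -> L -> L;
  slie_linearr : forall x, linear (slie x);
  slie_linearl : forall y, linear (slie^~ y);
  slie_grade : forall a b x y, x \in sgrade a -> y \in sgrade b ->
    slie x y \in sgrade (a (+) b);
  slie_skew : forall a b x y, x \in sgrade a -> y \in sgrade b ->
    slie x y = - ((-1) ^+ (a && b) *: slie y x);
  slie_alt : forall x, x \in sgrade false -> slie x x = 0;
  slie_jacobi : forall a b x y z, x \in sgrade a -> y \in sgrade b ->
    slie x (slie y z) =
      slie (slie x y) z + (-1) ^+ (a && b) *: slie y (slie x z) }.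

#[short(type="lieSuperalgType")]
HB.structure Definition LieSuperalgebra (k : fieldType) :=
  { L of Vector k L & Vector_isLieSuperalgebra k L }.

Section LieAlgebraNotions.
Variables (k : fieldType) (L : lieAlgType k).

Definition lie_ideal (I : {vspace L}) : Prop :=
  forall x y, y \in I -> lie x y \in I.

Definition lie_simple : Prop :=
  (exists x y : L, lie x y != 0) /\
  (forall I : {vspace L}, lie_ideal I -> I = 0%VS \/ I = fullv).

(* ad h is diagonalizable; this is the usual notion of a semisimple element
   when L is semisimple and k is algebraically closed. *)
Definition lie_semisimple_elt (h : L) : Prop :=
  exists2 e : seq L, basis_of fullv e
    & forall v, v \in e -> exists a : k, lie h v = a *: v.

Definition lie_nilpotent_elt (u : L) : Prop :=
  exists n : nat, forall v : L, iter n (lie u) v = 0.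

Definition lie_distinguished_nilpotent (u : L) : Prop :=
  lie_nilpotent_elt u /\
  (forall h : L, lie_semisimple_elt h -> lie u h = 0 -> h = 0).

End LieAlgebraNotions.

Section EvenPart.
Variables (k : fieldType) (g : lieSuperalgType k).

Definition even_part : Type := subvs_of (@sgrade k g false).
HB.instance Definition _ := Vector.on even_part.

Definition even_lie (x y : even_part) : even_part :=
  vsproj (sgrade false) (slie (vsval x) (vsval y)).

Lemma even_lieE x y : vsval (even_lie x y) = slie (vsval x) (vsval y).
Proof. by rewrite vsprojK // (@slie_grade _ _ false false) ?subvsP. Qed.

Fact even_lie_linearr x : linear (even_lie x).
Proof.
by move=> a y z; apply: subvs_inj; rewrite linearP /= !even_lieE;
   rewrite linearP slie_linearr.
Qed.

Fact even_lie_linearl y : linear (even_lie^~ y).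
Proof.
by move=> a x z; apply: subvs_inj; rewrite linearP /= !even_lieE;
   rewrite linearP slie_linearl.
Qed.

Fact even_lie_alt x : even_lie x x = 0.
Proof. by apply: subvs_inj; rewrite even_lieE slie_alt ?subvsP ?linear0. Qed.

Fact even_lie_jacobi x y z :
  even_lie x (even_lie y z)
  = even_lie (even_lie x y) z + even_lie y (even_lie x z).
Proof.
apply: subvs_inj; rewrite linearD /= !even_lieE.
by rewrite (@slie_jacobi _ _ false false) ?subvsP //= expr0 scale1r.
Qed.

HB.instance Definition _ := Vector_isLieAlgebra.Build k even_part
  even_lie_linearr even_lie_linearl even_lie_alt even_lie_jacobi.

End EvenPart.

Section SuperNotions.
Variables (k : fieldType) (g : lieSuperalgType k).

Definition in_scenter (z : g) : Prop := forall y : g, slie z y = 0.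

(* Meant for odd x. *)
Definition sdistinguished (x : g) : Prop :=
  forall h : even_part g, lie_semisimple_elt h ->
    slie (vsval h) x = 0 -> in_scenter (vsval h).

End SuperNotions.

Section Takiff.
Variables (k : fieldType) (s : lieAlgType k).

(* The triple (u, (v, c)) stands for u + xi v + c d/dxi. *)
Definition takiff : Type := (s * (s * k^o))%type.
HB.instance Definition _ := Vector.on takiff.

Definition takiff_ev (u : s) : takiff := (u, (0, 0)).
Definition takiff_xi (u : s) : takiff := (0, (u, 0)).
Definition takiff_d : takiff := (0, (0, 1)).

(* [u + xi v + c d, u' + xi v' + c' d]
     = [u, u'] + c v' + c' v + xi ([u, v'] + [v, u']) *)
Definition takiff_lie (x y : takiff) : takiff :=
  (lie x.1 y.1 + (x.2.2 : k) *: y.2.1 + (y.2.2 : k) *: x.2.1,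
   (lie x.1 y.2.1 + lie x.2.1 y.1, 0)).

Definition takiff_grade (b : bool) : {vspace takiff} :=
  if b then lker (linfun (fst : takiff -> s))
  else lker (linfun (snd : takiff -> s * k^o)).

Lemma takiff_evenP (x : takiff) :
  reflect (exists u, x = takiff_ev u) (x \in takiff_grade false).
Proof.
rewrite memv_ker lfunE /=; apply: (iffP eqP) => [|[u ->]] //.
by case: x => u w /= ->; exists u.
Qed.

Lemma takiff_oddP (x : takiff) :
  reflect (exists u c, x = takiff_xi u + c *: takiff_d)
          (x \in takiff_grade true).
Proof.
rewrite memv_ker lfunE /=; apply: (iffP eqP) => [|[u [c ->]]] /=; last first.
  by rewrite scaler0 addr0.
case: x => w [u c] /= ->; exists u, c; congr (_, (_, _)) => /=.
- by rewrite scaler0 addr0.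
- by rewrite scaler0 addr0.
- by rewrite add0r; apply/esym/mulr1.
Qed.

Let lie0 (x : s) : lie x 0 = 0.
Proof.
by have := lie_linearr x (-1) 0 0; rewrite scaleN1r addNr => ->;
   rewrite scaleN1r addNr.
Qed.
Let lie0l (x : s) : lie 0 x = 0.
Proof.
by have := lie_linearl x (-1) 0 0; rewrite scaleN1r addNr => ->;
   rewrite scaleN1r addNr.
Qed.
Let lieD (x y z : s) : lie x (y + z) = lie x y + lie x z.
Proof. by have := lie_linearr x 1 y z; rewrite !scale1r. Qed.
Let lieDl (x y z : s) : lie (y + z) x = lie y x + lie z x.
Proof. by have := lie_linearl x 1 y z; rewrite !scale1r. Qed.
Let lieZ a (x y : s) : lie x (a *: y) = a *: lie x y.
Proof. by have := lie_linearr x a y 0; rewrite !addr0 lie0 addr0. Qed.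
Let lieZl a (x y : s) : lie (a *: y) x = a *: lie y x.
Proof. by have := lie_linearl x a y 0; rewrite !addr0 lie0l addr0. Qed.
Let lieC (x y : s) : lie x y = - lie y x.
Proof.
have := lie_alt (x + y); rewrite lieD !lieDl !lie_alt add0r addr0.
by move/eqP; rewrite addrC addr_eq0 => /eqP.
Qed.

Fact takiff_grade_full : (takiff_grade false + takiff_grade true = fullv)%VS.
Proof.
apply/vspaceP => -[u [v c]]; rewrite memvf.
have ->: (u, (v, c)) = takiff_ev u + (takiff_xi v + c *: takiff_d) :> takiff.
  congr (_, (_, _)) => /=; rewrite ?scaler0 ?addr0 ?add0r //.
  by apply/esym/mulr1.
apply: memv_add; first by apply/takiff_evenP; exists u.
by apply/takiff_oddP; exists v, c.
Qed.

Fact takiff_grade_direct : (takiff_grade false :&: takiff_grade true = 0)%VS.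
Proof.
apply/vspaceP => -[u w]; rewrite memv_cap !memv_ker !lfunE /= memv0.
by rewrite -pair_eqE /= andbC.
Qed.

Let takE (x y : takiff) : x.1 = y.1 -> x.2.1 = y.2.1 -> x.2.2 = y.2.2 -> x = y.
Proof. by case: x => ? [? ?]; case: y => ? [? ?] /= -> -> ->. Qed.

Fact takiff_lie_linearr x : linear (takiff_lie x).
Proof.
move=> a y z; apply: takE => /=; last by rewrite scaler0 addr0.
  rewrite lieD lieZ !scalerDr scalerDl !scalerA (mulrC a x.2.2).
  by rewrite (AC (2*2*2) ((1*3*5)*(2*4*6))%AC).
by rewrite !lieD !lieZ !scalerDr addrACA.
Qed.

Fact takiff_lie_linearl y : linear (takiff_lie^~ y).
Proof.
move=> a x z; apply: takE => /=; last by rewrite scaler0 addr0.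
  rewrite lieDl lieZl !scalerDr scalerDl !scalerA (mulrC a y.2.2).
  by rewrite (AC (2*2*2) ((1*3*5)*(2*4*6))%AC).
by rewrite !lieDl !lieZl !scalerDr addrACA.
Qed.

Let gradeE b (x : takiff) : x \in takiff_grade b ->
  x = if b then (0, x.2) else (x.1, (0, 0)).
Proof.
by case: b; rewrite memv_ker lfunE /= => /eqP; case: x => ? ? /= ->.
Qed.

Let gradeI b (x : takiff) : (if b then x.1 = 0 else x.2 = 0) ->
  x \in takiff_grade b.
Proof. by case: b; rewrite memv_ker lfunE /= => ->. Qed.

Let simp := (lie0, lie0l, scale0r, scaler0, addr0, add0r, oppr0).

Fact takiff_lie_grade a b x y : x \in takiff_grade a -> y \in takiff_grade b ->
  takiff_lie x y \in takiff_grade (a (+) b).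
Proof.
move=> /gradeE-> /gradeE->; apply: gradeI.
by case: a; case: b; rewrite /= ?simp.
Qed.

Fact takiff_lie_skew a b x y : x \in takiff_grade a -> y \in takiff_grade b ->
  takiff_lie x y = - ((-1) ^+ (a && b) *: takiff_lie y x).
Proof.
move=> /gradeE-> /gradeE->.
case: a; case: b; apply: takE => /=;
  rewrite ?expr0 ?expr1 ?scale1r ?scaleN1r ?opprK ?simp //;
  first [exact: addrC | exact: lieC].
Qed.

Fact takiff_lie_alt x : x \in takiff_grade false -> takiff_lie x x = 0.
Proof. by move=> /gradeE->; apply: takE; rewrite /= ?simp ?lie_alt. Qed.

Fact takiff_lie_jacobi a b x y z :
  x \in takiff_grade a -> y \in takiff_grade b ->
  takiff_lie x (takiff_lie y z) =
    takiff_lie (takiff_lie x y) z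
    + (-1) ^+ (a && b) *: takiff_lie y (takiff_lie x z).
Proof.
move=> /gradeE-> /gradeE->.
case: a; case: b; apply: takE => /=;
  rewrite ?expr0 ?expr1 ?scale1r ?scaleN1r ?simp //;
  rewrite ?(lieD, lieDl, lieZ, lieZl, scalerDr, scalerDl).
- by rewrite addrK.
- by rewrite opprD addrACA subrr add0r (lieC y.2.1 x.2.1) scalerN opprK.
- by rewrite addrCA (lieC y.1 x.2.1) scalerN subrr addr0.
- exact: lie_jacobi.
- by rewrite addrC.
- exact: lie_jacobi.
- exact: lie_jacobi.
- exact: lie_jacobi.
Qed.

HB.instance Definition _ := Vector_isLieSuperalgebra.Build k takiff
  takiff_grade_full takiff_grade_direct takiff_lie_linearr takiff_lie_linearl
  takiff_lie_grade takiff_lie_skew takiff_lie_alt takiff_lie_jacobi.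

Lemma takiff_relations (u v : s) :
  [/\ slie (takiff_ev u) (takiff_ev v) = takiff_ev (lie u v),
      slie (takiff_ev u) (takiff_xi v) = takiff_xi (lie u v) &
      slie (takiff_xi u) (takiff_xi v) = 0] /\
  [/\ slie takiff_d (takiff_xi u) = takiff_ev u,
      slie takiff_d (takiff_ev u) = 0 & slie takiff_d takiff_d = 0].
Proof.
by split; split; apply: takE; rewrite /= ?simp ?scale1r.
Qed.

End Takiff.

(* Main.v *)
(* An even element h commutes with lam d + xi u iff [h, u] = 0, and s has
   trivial center, so the point is that u is nilpotent as soon as no nonzero
   semisimple h commutes with it.  If u is not nilpotent, some eigenvalue a_i
   of ad u (listed along a basis of generalized eigenvectors) is nonzero, and
   there is a nonzero integer-valued f on the indices preserving all integral
   linear relations between the a_i.  The operator D acting by f_i on the i-th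
   basis vector is a diagonalizable derivation killing u.  Moreover
   tr(D ad u) = sum_i f_i a_i is nonzero, for otherwise sum_i f_i^2 = 0.  As
   tr(D ad [y, z]) is the Killing form of (D y, z), the Killing form is not
   zero, hence is nondegenerate by simplicity, hence D = ad h for some h, which
   contradicts the hypothesis. *)
From HB Require Import structures.
Require Import Defs.
From mathcomp Require Import all_boot all_order all_algebra.
From Stdlib Require Import Classical.
Import GRing.Theory Num.Theory.
Set Implicit Arguments.
Unset Strict Implicit.
Unset Printing Implicit Defensive.

Local Open Scope ring_scope.

(** * Integral linear relations between scalars *)

(** Induction on [n]. If the [a i] satisfy no nontrivial integral relation, only [r = 0] is tested
    and [f] may be constant. Otherwise a relation [m] with [m i] nonzero ties [a i] to the other
    values, and the index [i] is removed. *)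
Lemma exists_int_additive (k : fieldType) (char_k : [pchar k] =i pred0)
    (n : nat) (a : 'I_n -> k) :
  (exists j, a j != 0) ->
  exists2 f : 'I_n -> int, exists j, f j != 0
    & forall r : 'I_n -> int,
        \sum_i (r i)%:~R * a i = 0 -> \sum_i r i * f i = 0.
Proof.
elim: n a => [|n IHn] a [j a_j]; first by case: j a_j.
have [[m m0 [i mi]]|indep] := classic (exists2 m : 'I_n.+1 -> int,
  \sum_i (m i)%:~R * a i = 0 & exists i, m i != 0); last first.
  exists (fun=> 1) => [|r r0]; first by exists j.
  rewrite big1 // => i _; rewrite mulr1; apply/eqP; apply: contraT => ri.
  by case: indep; exists r => //; exists i.
have mi_k : (m i)%:~R != 0 :> k.
  case: (m i) mi => p mi; rewrite ?NegzE ?mulrNz ?oppr_eq0.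
    by rewrite (proj1 (pcharf0P k) char_k).
  by rewrite -pmulrn (proj1 (pcharf0P k) char_k).
move: m0; rewrite (bigD1_ord i) //= => m0.
have [|f [l fl] fP] := IHn (a \o lift i).
  (* If all other values vanished, the relation [m] would make [a i] vanish too, as [m i] is nonzero
     in [k]. *)
  apply: NNPP => all0; case/negP: a_j; apply/eqP.
  have a0 l : a (lift i l) = 0.
    by apply/eqP; apply: contraT => al; case: all0; exists l.
  case: (unliftP i j) => [l ->|->]; first exact: a0.
  move: m0; rewrite big1 => [|l _]; last by rewrite a0 mulr0.
  by move/eqP; rewrite addr0 mulf_eq0 (negPf mi_k) => /eqP.
(* f is extended from the other indices by solving the relation m for a i,
   after scaling by m i to remain integral. *)
pose g j := if unlift i j is Some l then m i * f l
            else - \sum_l m (lift i l) * f l.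
exists g => [|r r0].
  by exists (lift i l); rewrite /g liftK mulf_neq0.
rewrite (bigD1_ord i) //= {1}/g unlift_none.
under eq_bigr do rewrite /g liftK.
have lin (R : comNzRingType) (c d : R) (x y z : 'I_n -> R) :
    \sum_l (c * x l - d * y l) * z l
    = c * \sum_l x l * z l - d * \sum_l y l * z l.
  by rewrite !mulr_sumr -sumrB; apply: eq_bigr => ? _; rewrite mulrBl !mulrA.
(* This combination of the relations [r] and [m] eliminates [a i]. *)
have := fP (fun l => m i * r (lift i l) - r i * m (lift i l)); rewrite lin.
rewrite (eq_bigr (fun l => ((m i)%:~R * (r (lift i l))%:~R
    - (r i)%:~R * (m (lift i l))%:~R) * a (lift i l))); last first.
  by move=> l' _; rewrite mulrzBr !intrM.
rewrite lin mulrN addrC => fr.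
under eq_bigr => l' _ do rewrite mulrCA.
rewrite -mulr_sumr; apply: fr.
move: r0; rewrite (bigD1_ord i) //= => /eqP; rewrite addr_eq0 => /eqP r0.
move: m0 => /eqP; rewrite addr_eq0 => /eqP m0.
rewrite -[X in _ * X - _]opprK -r0 -[X in _ - _ * X]opprK -m0.
by rewrite !mulrN opprK mulrCA addNr.
Qed.

(** * Nilpotent matrices and generalized eigenvectors *)

(** Every eigenvalue is zero, so the characteristic polynomial is a power of ['X]; its subleading
    coefficient is minus the trace. *)
Lemma nilpotent_mxtrace (k : closedFieldType) (n m : nat) (A : 'M[k]_n) :
  A ^+ m = 0 -> \tr A = 0.
Proof.
case: n A => [|n] A Am; first by rewrite thinmx0 mxtrace0.
suff charA : char_poly A = 'X^(n.+1).
  by apply/eqP; rewrite -oppr_eq0 -char_poly_trace // charA coefXn /= ltn_eqF.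
have [r] := closed_field_poly_normal (char_poly A).
rewrite (monicP (char_poly_monic A)) scale1r => defA.
have r0 : {in r, forall z, z = 0}.
  move=> z rz; have : root (char_poly A) z by rewrite defA root_prod_XsubC.
  rewrite -eigenvalue_root_char => /eigenvalueP[v vA v0].
  have : v *m A ^+ m = z ^+ m *: v.
    elim: (m) => [|p IHp]; first by rewrite !expr0 mulmx1 scale1r.
    by rewrite exprS -mulmxE mulmxA vA -scalemxAl IHp scalerA exprS.
  rewrite Am mulmx0 => /esym/eqP; rewrite scaler_eq0 (negPf v0) orbF.
  by rewrite expf_eq0 => /andP[_ /eqP].
have: size (char_poly A) = n.+2 by rewrite size_char_poly.
rewrite defA size_prod_XsubC => /eqP; rewrite eqSS => /eqP <-.
elim: r r0 {defA} => [|z r IHr] r0; first by rewrite big_nil expr0.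
rewrite big_cons IHr => [|y ry]; last by rewrite [LHS]r0 // inE ry orbT.
by rewrite (r0 z) ?mem_head // subr0 exprS.
Qed.

(** The exponent is free and the zero vector is allowed, so that these vectors form a subspace for
    every scalar [a], eigenvalue or not. *)
Definition geigenvector (k : fieldType) n (A : 'M[k]_n) (a : k) (v : 'rV_n) :=
  exists m : nat, v *m (A - a%:M) ^+ m = 0.

Section GeneralizedEigenvectors.
Variables (k : fieldType) (n : nat) (A : 'M[k]_n).

Lemma geigenvector0 (a : k) : geigenvector A a 0.
Proof. by exists 0%N; rewrite mul0mx. Qed.

Lemma geigenvector_le a (v : 'rV[k]_n) m p : (m <= p)%N ->
  v *m (A - a%:M) ^+ m = 0 -> v *m (A - a%:M) ^+ p = 0.
Proof.
by move=> /subnKC <- vm; rewrite exprD -mulmxE mulmxA vm mul0mx.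
Qed.

Lemma geigenvectorD a v w :
  geigenvector A a v -> geigenvector A a w -> geigenvector A a (v + w).
Proof.
move=> [m vm] [p wp]; exists (maxn m p).
rewrite mulmxDl (geigenvector_le (leq_maxl m p) vm).
by rewrite (geigenvector_le (leq_maxr m p) wp) addr0.
Qed.

Lemma geigenvectorZ a c v : geigenvector A a v -> geigenvector A a (c *: v).
Proof. by move=> [m vm]; exists m; rewrite -scalemxAl vm scaler0. Qed.

End GeneralizedEigenvectors.

Lemma geigenvector_sum (k : fieldType) n (A : 'M[k]_n) a (I : finType)
    (P : pred I) (F : I -> 'rV_n) :
  (forall i, P i -> geigenvector A a (F i)) ->
  geigenvector A a (\sum_(i | P i) F i).
Proof.
move=> FP; elim/big_ind: _ => //; first exact: geigenvector0.
exact: geigenvectorD.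
Qed.

Lemma sub_kermxpolyP (k : fieldType) n (A : 'M[k]_n.+1) p (v : 'rV_n.+1) :
  reflect (v *m horner_mx A p = 0) (v <= kermxpoly A p)%MS.
Proof. exact: sub_kermxP. Qed.

Lemma geigenvector_poly (k : fieldType) n (A : 'M[k]_n.+1) a v :
  geigenvector A a v <->
  exists m : nat, (v <= kermxpoly A (('X - a%:P) ^+ m))%MS.
Proof.
have E m : horner_mx A (('X - a%:P) ^+ m) = (A - a%:M) ^+ m.
  by rewrite rmorphXn rmorphB /= horner_mx_X horner_mx_C.
split=> -[m vm]; exists m; first by apply/sub_kermxpolyP; rewrite E.
by rewrite -E; apply/sub_kermxpolyP.
Qed.

Lemma kermxpoly_dvd (k : fieldType) n (A : 'M[k]_n.+1) p q (v : 'rV_n.+1) :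
  p %| q -> (v <= kermxpoly A p)%MS -> (v <= kermxpoly A q)%MS.
Proof.
move=> /dvdpP[r ->] /sub_kermxpolyP vp; apply/sub_kermxpolyP.
by rewrite mulrC rmorphM -mulmxE mulmxA vp mul0mx.
Qed.

(** The characteristic polynomial splits into pairwise coprime powers of linear factors, whose
    kernels together span the space; a basis is extracted from their rows. *)
Lemma geigenvector_basis (k : closedFieldType) n (A : 'M[k]_n) :
  exists2 P : 'M_n, P \in unitmx
    & exists a : 'I_n -> k, forall i, geigenvector A (a i) (row i P).
Proof.
case: n A => [|n] A.
  by exists 1%:M; [exact: unitmx1|exists (fun=> 0) => -[]].
have [r] := closed_field_poly_normal (char_poly A).
rewrite (monicP (char_poly_monic A)) scale1r -prodr_undup_exp_count.
set s := undup r => defA.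
have Us : uniq s by apply: undup_uniq.
pose B (i : 'I_(size s)) :=
  kermxpoly A (('X - (s`_i)%:P) ^+ count_mem s`_i r).
have fullB : row_full (\mxcol_i B i).
  rewrite -sub1mx eqmx_col.
  have /(_ predT) := kermxpoly_prod A (p_ := fun i : 'I_(size s) =>
    ('X - (s`_i)%:P) ^+ count_mem s`_i r).
  rewrite -(big_mkord predT (fun i => ('X - (s`_i)%:P) ^+ count_mem s`_i r)).
  rewrite -(big_nth 0 predT (fun z => ('X - z%:P) ^+ count_mem z r)) -defA.
  (* By Cayley-Hamilton the kernel of the characteristic polynomial is everything. *)
  have := kermxpoly_min (mxminpoly_dvd_char A) => ker1 kerB.
  have : (1%:M <= kermxpoly A (char_poly A))%MS by rewrite ker1.
  rewrite kerB => [le1B|i j _ _ ij].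
    apply: (submx_trans le1B); apply/sumsmx_subP => i _.
    by rewrite (sumsmx_sup i) // genmxE.
  rewrite coprimep_expr ?coprimep_expl // coprimep_XsubC root_XsubC.
  by rewrite nth_uniq.
exists (rowsub (fullrankfun fullB) (\mxcol_i B i)).
  exact: fullrowsub_unit.
(* [tagnat.sig1] recovers the block from which a row was taken, hence its eigenvalue. *)
exists (fun i => s`_(tagnat.sig1 (fullrankfun fullB i))) => i.
apply/geigenvector_poly.
exists (count_mem s`_(tagnat.sig1 (fullrankfun fullB i)) r).
by rewrite row_rowsub row_mxcol row_sub.
Qed.

(** The part [w] of [v] along the rows with [a i] different from [b] is killed both by a power of
    ['X - b%:P] and by a polynomial coprime to it, so it vanishes. *)
Lemma geigenvector_coord (k : fieldType) n (A P : 'M[k]_n) (a : 'I_n -> k) b v :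
    P \in unitmx -> (forall i, geigenvector A (a i) (row i P)) ->
    geigenvector A b v ->
  forall i, (v *m invmx P) 0 i != 0 -> a i = b.
Proof.
case: n A P a v => [|n] A P a v Pu aP vP i; first by case: i.
set c := v *m invmx P.
have defv : v = \sum_i c 0 i *: row i P.
  by rewrite -mulmx_sum_row mulmxKV.
pose w := \sum_(i | a i != b) c 0 i *: row i P.
have wb : geigenvector A b w.
  have -> : w = v - \sum_(i | a i == b) c 0 i *: row i P.
    apply/esym/eqP; rewrite subr_eq addrC {1}defv.
    by rewrite (bigID (fun i => a i == b)).
  apply: geigenvectorD => //; rewrite -scaleN1r; apply: geigenvectorZ.
  by apply: geigenvector_sum => j /eqP <-; apply: geigenvectorZ.
have {}aP j := proj1 (geigenvector_poly _ _ _) (aP j).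
have [m mP] := fin_all_exists aP.
have wq : (w <= kermxpoly A (\prod_(j | a j != b) ('X - (a j)%:P) ^+ m j))%MS.
  apply: summx_sub => j ajb; apply: scalemx_sub.
  by apply: kermxpoly_dvd (mP j); rewrite (bigD1 j) //= dvdp_mulr.
have [p wp] := proj1 (geigenvector_poly _ _ _) wb.
have coprime_bq :
    coprimep (('X - b%:P) ^+ p) (\prod_(j | a j != b) ('X - (a j)%:P) ^+ m j).
  apply: coprimep_expl; elim/big_rec: _ => [|j q ajb qP].
    exact: coprimep1.
  rewrite coprimepMr qP andbT; apply: coprimep_expr.
  by rewrite coprimep_XsubC root_XsubC.
have w0 : w = 0.
  apply/eqP; rewrite -submx0 -(mxdirect_kermxpoly A coprime_bq).
  by rewrite sub_capmx wp.
move=> ci; apply: contraNeq ci => aib.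
have : w *m invmx P = 0 by rewrite w0 mul0mx.
rewrite mulmx_suml => /rowP/(_ i); rewrite summxE (bigD1 i) //= big1.
  rewrite -scalemxAl -row_mul mulmxV // row1 !mxE !eqxx mulr1 addr0.
  by move/eqP.
move=> j /andP[_ ji]; rewrite -scalemxAl -row_mul mulmxV // row1 !mxE.
by rewrite eqxx (eq_sym i) (negPf ji) mulr0.
Qed.

Lemma mulmx_conj_diag (k : fieldType) n (P : 'M[k]_n) (d v : 'rV_n) c :
    P \in unitmx -> (forall i, (v *m invmx P) 0 i != 0 -> d 0 i = c) ->
  v *m (invmx P *m diag_mx d *m P) = c *: v.
Proof.
move=> Pu dc; rewrite !mulmxA -[c *: v](mulmxKV Pu); congr (_ *m P).
rewrite -scalemxAl; apply/rowP => i; rewrite mul_mx_diag [LHS]mxE [RHS]mxE.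
have [->|/dc ->] := eqVneq ((v *m invmx P) 0 i) 0; first by rewrite mul0r mulr0.
exact: mulrC.
Qed.

Import VectorInternalTheory.

(** * Adjoint operators, trace forms and derivations *)

Section LieAlgebra.
Variables (k : fieldType) (s : lieAlgType k).
Implicit Types (x y z u h : s) (D M : 'M[k]_(dim s)).

HB.instance Definition _ x :=
  GRing.isLinear.Build k s s *:%R (lie x) (lie_linearr x).

Lemma lieDl x y z : lie (x + y) z = lie x z + lie y z.
Proof. by have := lie_linearl z 1 x y; rewrite !scale1r. Qed.

Lemma lie0l x : lie 0 x = 0.
Proof. by apply: (addrI (lie 0 x)); rewrite -lieDl !addr0. Qed.

Lemma lieZl a x y : lie (a *: x) y = a *: lie x y.
Proof. by have := lie_linearl y a x 0; rewrite !addr0 lie0l addr0. Qed.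

Lemma lieC x y : lie x y = - lie y x.
Proof.
have := lie_alt (x + y); rewrite linearD /= !lieDl !lie_alt add0r addr0.
by move/eqP; rewrite addrC addr_eq0 => /eqP.
Qed.

Definition ad x : 'M[k]_(dim s) := lin1_mx (v2r \o lie x \o r2v).

Lemma mul_v2r_ad x y : v2r y *m ad x = v2r (lie x y).
Proof. by rewrite mul_rV_lin1 /= v2rK. Qed.

Lemma v2r_mx_inj M M' : (forall x, v2r x *m M = v2r x *m M') -> M = M'.
Proof.
by move=> eqM; apply/row_matrixP => i; rewrite !rowE -(r2vK (delta_mx 0 i)).
Qed.

Fact ad_is_linear : linear ad.
Proof.
move=> a x y; apply: v2r_mx_inj => z.
by rewrite mulmxDr -scalemxAr !mul_v2r_ad lieDl lieZl linearP.
Qed.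
HB.instance Definition _ := GRing.isLinear.Build k s 'M[k]_(dim s) *:%R ad
  ad_is_linear.

(* Coordinates are row vectors, so composition of operators is reversed. *)
Lemma ad_lie x y : ad (lie x y) = ad y *m ad x - ad x *m ad y.
Proof.
apply: v2r_mx_inj => z; rewrite mulmxBr !mulmxA !mul_v2r_ad -linearB /=.
by rewrite lie_jacobi addrK.
Qed.

(** The Leibniz rule, solved for the adjoint operator of the image of [x] under [D]. *)
Definition derivation D :=
  forall x, ad (r2v (v2r x *m D)) = ad x *m D - D *m ad x.

Lemma ad_derivation x : derivation (ad x).
Proof. by move=> y; rewrite mul_v2r_ad v2rK ad_lie. Qed.

(** The coordinates of the linear form sending [x] to [\tr (M *m ad x)]; for [M = ad y] this is the
    Killing form paired with [y]. *)
Definition trace_form M : 'rV[k]_(dim s) :=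
  \row_j \tr (M *m ad (r2v (delta_mx 0 j))).

Fact trace_form_is_linear : linear trace_form.
Proof.
move=> a M M'; apply/rowP => j.
by rewrite !mxE mulmxDl -scalemxAl mxtraceD mxtraceZ.
Qed.
HB.instance Definition _ := GRing.isLinear.Build k 'M[k]_(dim s)
  'rV[k]_(dim s) *:%R trace_form trace_form_is_linear.

Lemma trace_formE M x : \tr (M *m ad x) = \sum_j v2r x 0 j * trace_form M 0 j.
Proof.
rewrite -[in LHS](v2rK x) [v2r x in LHS]row_sum_delta !linear_sum /=.
by apply: eq_bigr => j _; rewrite !linearZ !mxE.
Qed.

Lemma trace_form_eq0 M :
  trace_form M = 0 <-> (forall x, \tr (M *m ad x) = 0).
Proof.
split=> [M0 x|M0]; last by apply/rowP => j; rewrite !mxE M0.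
by rewrite trace_formE M0 big1 // => j _; rewrite mxE mulr0.
Qed.

(** The second hypothesis makes the kernel of [f] an ideal. Simplicity is applied in this form to
    [ad], to the Killing form and to a trace functional. *)
Lemma lie_simple_ker (W : vectType k) (f : {linear s -> W}) :
    lie_simple s -> (forall x y, f y = 0 -> f (lie x y) = 0) ->
  (forall y, f y = 0 -> y = 0) \/ (forall y, f y = 0).
Proof.
move=> [_ ideals] f_lie; have [x y|ker0|kerT] := ideals (lker (linfun f)).
- by rewrite !memv_ker !lfunE => /eqP fy; apply/eqP; exact: f_lie.
- left=> y fy; apply/eqP; rewrite -memv0 -ker0 memv_ker lfunE; exact/eqP.
- by right=> y; apply/eqP; rewrite -(lfunE f) -memv_ker kerT memvf.
Qed.

Lemma lie_simple_center x : lie_simple s -> (forall y, lie x y = 0) -> x = 0.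
Proof.
move=> simple_s x_central.
have adP z : ad z = 0 <-> forall y, lie z y = 0.
  split=> [z0 y|z0].
    by apply: (can_inj v2rK); rewrite -mul_v2r_ad z0 mulmx0 linear0.
  by apply: v2r_mx_inj => y; rewrite mul_v2r_ad z0 linear0 mulmx0.
have [y z|ad0|ad0] := lie_simple_ker (f := ad) simple_s.
- by move=> /= z0; rewrite ad_lie z0 mulmx0 mul0mx subrr.
- by apply: ad0; apply/adP.
- by case: simple_s => -[y [z]]; rewrite (proj1 (adP y)) ?eqxx.
Qed.

(** Both sides expand to the same products up to cyclic permutation under the trace. The right side
    is the Killing form of the image of [x] under [D] with [y]. *)
Lemma trace_derivation D x y :
  derivation D -> \tr (D *m ad (lie x y)) = \tr (ad (r2v (v2r x *m D)) *m ad y).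
Proof.
move=> derD; rewrite derD ad_lie mulmxBr mulmxBl !raddfB /=.
by rewrite -(mulmxA (ad x)) [in RHS]mxtrace_mulC !mulmxA.
Qed.

Lemma derivationB D M : derivation D -> derivation M -> derivation (D - M).
Proof.
move=> derD derM x; rewrite mulmxBr !raddfB /= derD derM.
by rewrite mulmxBl !opprD !opprK addrACA.
Qed.

(** This takes the place of Cartan's criterion. If the radical were all of [s], the functional
    [\tr (D *m ad y)] of [y] would vanish on brackets; its kernel would be a nonzero ideal, hence
    all of [s], against the assumption on [u]. *)
Lemma killing_nondegenerate D u x :
    lie_simple s -> derivation D -> \tr (D *m ad u) != 0 ->
  trace_form (ad x) = 0 -> x = 0.
Proof.
move=> simple_s derD trDu.
have [y z /trace_form_eq0 z0|nondeg|killing0] :=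
  lie_simple_ker (f := trace_form \o ad) simple_s.
(* Invariance of the Killing form is [trace_derivation] for the derivation [ad w]. *)
- apply/trace_form_eq0 => w /=.
  rewrite mxtrace_mulC (trace_derivation _ _ (ad_derivation w)) mxtrace_mulC.
  exact: z0.
- exact: nondeg.
have trD y z : \tr (D *m ad (lie y z)) = 0.
  rewrite trace_derivation //; exact: (proj1 (trace_form_eq0 _) (killing0 _)).
pose f y : k^o := \tr (D *m ad y).
have f_lin : linear f.
  by move=> a y z; rewrite /f linearP mulmxDr linearD -scalemxAr linearZ.
pose F : {linear s -> k^o} := HB.pack f (GRing.isLinear.Build _ _ _ _ f f_lin).
have [y z _|f0|f0] := lie_simple_ker (f := F) simple_s; first exact: trD.
  by case: simple_s => -[y [z /eqP yz]] _; case: yz; apply: f0; apply: trD.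
by have := f0 u; rewrite /= /f => /eqP; rewrite (negPf trDu).
Qed.

(** The Gram matrix [T] of the Killing form is invertible, which yields [h] such that [D - ad h] has
    zero trace form. By [trace_derivation] the image of this derivation is then orthogonal to [s],
    so it is zero. *)
Lemma derivation_inner D :
    (forall x, trace_form (ad x) = 0 -> x = 0) -> derivation D ->
  exists h, D = ad h.
Proof.
move=> nondeg derD; pose T := lin1_mx (trace_form \o ad \o r2v).
have Tu : T \in unitmx.
  rewrite -row_free_unit -kermx_eq0; apply/eqP/row_matrixP => i.
  have /sub_kermxP := row_sub i (kermx T); rewrite mul_rV_lin1 /= => /nondeg.
  by move=> r0; apply: (can_inj r2vK); rewrite r0 row0 linear0.
pose h := r2v (trace_form D *m invmx T).
have trh : trace_form (D - ad h) = 0.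
  rewrite linearB /=; apply/eqP; rewrite subr_eq0; apply/eqP.
  have <- : (trace_form D *m invmx T) *m T = trace_form (ad h).
    by rewrite mul_rV_lin1.
  by rewrite mulmxKV.
exists h; apply/eqP; rewrite -subr_eq0; apply/eqP; apply: v2r_mx_inj => x.
have derB := derivationB derD (ad_derivation h).
rewrite mulmx0; apply: (can_inj r2vK); rewrite [RHS]linear0; apply: nondeg.
apply/trace_form_eq0 => y; rewrite -trace_derivation //.
exact: (proj1 (trace_form_eq0 _) trh).
Qed.

(** Subtracting [a + b] from [ad u] on a bracket amounts to subtracting [a] on the first factor and
    [b] on the second; induction on a bound for the sum of the two exponents. *)
Lemma geigenvector_lie u a b x y :
    geigenvector (ad u) a (v2r x) -> geigenvector (ad u) b (v2r y) ->
  geigenvector (ad u) (a + b) (v2r (lie x y)).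
Proof.
have shift c z : v2r z *m (ad u - c%:M) = v2r (lie u z - c *: z).
  by rewrite mulmxBr mul_v2r_ad mul_mx_scalar -linearZ -linearB.
move=> [p] + [q]; move: {2}(p + q)%N (leqnn (p + q)) => l.
have null c z : v2r z *m (ad u - c%:M) ^+ 0 = 0 -> z = 0.
  by rewrite expr0 mulmx1 => z0; apply: (can_inj v2rK); rewrite z0 linear0.
elim: l p q x y => [|l IHl] [|p] [|q] x y //;
  try by move=> _ /null -> _; rewrite lie0l linear0; exact: geigenvector0.
  by move=> _ _ /null ->; rewrite !linear0; exact: geigenvector0.
rewrite addSn addnS ltnS => pq xp yq.
have leib : lie u (lie x y) - (a + b) *: lie x y
    = lie (lie u x - a *: x) y + lie x (lie u y - b *: y).
  rewrite lie_jacobi lieDl -(scaleNr a x) lieZl scaleNr.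
  rewrite [lie x (_ - _)]linearB /= [lie x (b *: y)]linearZ /=.
  by rewrite scalerDl opprD addrACA.
have [|||m xm] := IHl p q.+1 (lie u x - a *: x) y.
- by rewrite addnS.
- by rewrite -shift -mulmxA mulmxE -exprS.
- by [].
have [|||m' ym] := IHl p.+1 q x (lie u y - b *: y).
- by rewrite addSn.
- by [].
- by rewrite -shift -mulmxA mulmxE -exprS.
have [m'' lm] : geigenvector (ad u) (a + b)
    (v2r (lie u (lie x y) - (a + b) *: lie x y)).
  by rewrite leib linearD; apply: geigenvectorD; [exists m|exists m'].
by exists m''.+1; rewrite exprS -mulmxE mulmxA shift.
Qed.

End LieAlgebra.
Prenex Implicits ad.

(** * The diagonalizable derivation built from an integer-valued function *)

Section AdaptedDerivation.
Variables (k : closedFieldType) (s : lieAlgType k).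
Implicit Types x y : s.

Let adZ c x : ad (c *: x) = c *: ad x. Proof. exact: linearZ. Qed.
Let lieZr c x y : lie x (c *: y) = c *: lie x y. Proof. exact: linearZ. Qed.
Let v2rZ c x : v2r (c *: x) = c *: v2r x. Proof. exact: linearZ. Qed.

Variables (u : s) (P : 'M[k]_(dim s)) (a : 'I_(dim s) -> k).
Hypothesis Pu : P \in unitmx.
Hypothesis aP : forall i, geigenvector (ad u) (a i) (row i P).
Variable f : 'I_(dim s) -> int.
Hypothesis fP : forall r : 'I_(dim s) -> int,
  \sum_i (r i)%:~R * a i = 0 -> \sum_i r i * f i = 0.

Let d : 'rV[k]_(dim s) := \row_i (f i)%:~R.
Let D : 'M[k]_(dim s) := invmx P *m diag_mx d *m P.
Let e i : s := r2v (row i P).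

Let pick (i j : 'I_(dim s)) : int := (j == i)%:R.

(** Stated over any ring, to be read in [k] for [a] and in [int] for [f]. *)
Let sum_pick (R : pzRingType) (g : 'I_(dim s) -> R) i :
  \sum_j (pick i j)%:~R * g j = g i.
Proof.
rewrite (bigD1 i) //= /pick eqxx mul1r big1 ?addr0 // => j /negPf ->.
by rewrite mul0r.
Qed.

Let additive i j l : a i + a j = a l -> f i + f j = f l.
Proof.
move=> aijl; apply/eqP; rewrite -subr_eq0.
have pick3 (R : pzRingType) (g : 'I_(dim s) -> R) :
    \sum_t (pick i t + pick j t - pick l t)%:~R * g t = g i + g j - g l.
  rewrite -(sum_pick g i) -(sum_pick g j) -(sum_pick g l) -big_split -sumrB.
  by apply: eq_bigr => t _; rewrite mulrzBr mulrzDr mulrBl mulrDl.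
have := fP (r := fun t => pick i t + pick j t - pick l t).
rewrite pick3 aijl subrr => /(_ erefl) <-; rewrite -pick3; apply/eqP.
by apply: eq_bigr => t _; rewrite intz.
Qed.

Let null l : a l = 0 -> f l = 0.
Proof.
move=> al; apply: (addrI (f l)); rewrite addr0; apply: additive.
by rewrite al addr0.
Qed.

Let const i j : a i = a j -> f i = f j.
Proof.
move=> aij; have := fP (r := fun t => pick i t - pick j t).
have pick2 (R : pzRingType) (g : 'I_(dim s) -> R) :
    \sum_t (pick i t - pick j t)%:~R * g t = g i - g j.
  rewrite -(sum_pick g i) -(sum_pick g j) -sumrB.
  by apply: eq_bigr => t _; rewrite mulrzBr mulrBl.
rewrite pick2 aij subrr => /(_ erefl) fij; apply/eqP; rewrite -subr_eq0 -pick2.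
by apply/eqP; rewrite -[RHS]fij; apply: eq_bigr => t _; rewrite intz.
Qed.

(** [b] need not be one of the [a i]: in that case [v] is zero and [c] is arbitrary. This covers
    brackets of basis vectors whose eigenvalues add up to no eigenvalue. *)
Let mulD b c v : geigenvector (ad u) b v ->
  (forall i, a i = b -> (f i)%:~R = c) -> v *m D = c *: v.
Proof.
move=> vb fc; apply: mulmx_conj_diag => // i vi; rewrite mxE.
by apply: fc; apply: geigenvector_coord vi.
Qed.

Let mul_rowD i v : geigenvector (ad u) (a i) v -> v *m D = (f i)%:~R *: v.
Proof. by move=> vi; apply: (mulD vi) => j /const ->. Qed.

Let row_D i : row i P *m D = (f i)%:~R *: row i P.
Proof. exact: mul_rowD. Qed.

Let row_e i : v2r (e i) = row i P. Proof. exact: r2vK. Qed.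

Let mul_eD i : v2r (e i) *m D = v2r ((f i)%:~R *: e i).
Proof. by rewrite v2rZ row_e row_D. Qed.

Let e_eq (M M' : 'M_(dim s)) :
  (forall i, v2r (e i) *m M = v2r (e i) *m M') -> M = M'.
Proof.
move=> eqM; suff PM : P *m M = P *m M'.
  by rewrite -[M](mulKmx Pu) PM mulKmx.
by apply/row_matrixP => i; rewrite !row_mul -row_e.
Qed.

Let e_expand x : x = \sum_i (v2r x *m invmx P) 0 i *: e i.
Proof.
apply: (can_inj v2rK); rewrite linear_sum -[LHS](mulmxKV Pu) mulmx_sum_row.
by apply: eq_bigr => i _; rewrite linearZ /= row_e.
Qed.

(** On basis vectors, the bracket of [e i] and [e j] is a generalized eigenvector for [a i + a j],
    where [D] acts by [f i + f j]. *)
Lemma adapted_derivation : derivation D.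
Proof.
have derE i : ad (r2v (v2r (e i) *m D)) = ad (e i) *m D - D *m ad (e i).
  apply: e_eq => j; rewrite mul_eD v2rK adZ mulmxBr (mulmxA _ _ D) (mulmxA _ D).
  rewrite mul_eD !mul_v2r_ad -scalemxAr mul_v2r_ad lieZr v2rZ.
  rewrite (mulD (b := a i + a j) (c := (f i)%:~R + (f j)%:~R)).
  - by rewrite scalerDl addrK.
  - by apply: geigenvector_lie; rewrite row_e.
  - by move=> l /esym/additive <-; rewrite mulrzDr.
move=> x; rewrite [x]e_expand (linear_sum v2r) mulmx_suml.
rewrite (linear_sum r2v) !(linear_sum ad).
rewrite mulmx_suml mulmx_sumr -sumrB; apply: eq_bigr => i _ /=.
by rewrite adZ v2rZ -!scalemxAl -scalemxAr (linearZ_LR r2v) adZ derE scalerBr.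
Qed.

(** Since [lie u u = 0], the vector [u] belongs to the eigenvalue 0, where [f] vanishes. *)
Lemma adapted_derivation_centralizes : v2r u *m D = 0.
Proof.
rewrite (mulD (b := 0) (c := 0)) ?scale0r //; last by move=> i /null ->.
exists 1%N; rewrite expr1 mulmxBr mul_v2r_ad lie_alt.
by rewrite linear0 raddf0 mulmx0 subr0.
Qed.

(** [S] is the semisimple part of [ad u]. As [D] is scalar on each generalized eigenspace,
    [D *m (ad u - S)] is nilpotent and has trace zero; [D] and [S] are both diagonal in the basis
    [P]. *)
Lemma adapted_derivation_trace : \tr (D *m ad u) = \sum_i (f i)%:~R * a i.
Proof.
pose S := invmx P *m diag_mx (\row_i a i) *m P.
have mul_rowS i v : geigenvector (ad u) (a i) v -> v *m S = a i *: v.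
  move=> vi; apply: mulmx_conj_diag => // j vj; rewrite mxE.
  exact: geigenvector_coord vj.
have step i v : geigenvector (ad u) (a i) v ->
    v *m (D *m (ad u - S)) = (f i)%:~R *: (v *m (ad u - (a i)%:M)).
  move=> vi; rewrite (mulmxA v D) (mul_rowD vi) -scalemxAl !mulmxBr.
  by rewrite (mul_rowS _ _ vi) mul_mx_scalar.
have nil i m v : geigenvector (ad u) (a i) v ->
    v *m (D *m (ad u - S)) ^+ m
    = (f i)%:~R ^+ m *: (v *m (ad u - (a i)%:M) ^+ m).
  move=> vi; elim: m => [|m IHm]; first by rewrite !expr0 scale1r.
  have gm : geigenvector (ad u) (a i) (v *m (ad u - (a i)%:M) ^+ m).
    case: vi => p vp; exists p; rewrite -mulmxA mulmxE -exprD.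
    exact: geigenvector_le (leq_addl _ _) vp.
  rewrite !exprSr -!mulmxE (mulmxA v) IHm -scalemxAl (step _ _ gm) scalerA.
  by rewrite mulmxA.
have [m mP] := fin_all_exists aP.
have trN : \tr (D *m (ad u - S)) = 0.
  apply: (@nilpotent_mxtrace _ _ (\max_i m i)).
  apply: e_eq => i; rewrite mulmx0 row_e (nil _ _ _ (aP i)).
  by rewrite (geigenvector_le (leq_bigmax i) (mP i)) scaler0.
have -> : ad u = S + (ad u - S) by rewrite addrC subrK.
rewrite mulmxDr mxtraceD trN addr0 /D /S !mulmxA mulmxK // -!mulmxA.
rewrite mxtrace_mulC !mulmxA mulmxK // mulmx_diag mxtrace_diag.
by apply: eq_bigr => i _; rewrite !mxE.
Qed.

Lemma adapted_semisimple h : D = ad h -> lie_semisimple_elt h.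
Proof.
move=> Dh; exists [seq e i | i <- enum 'I_(dim s)].
  rewrite basisEdim size_map size_enum_ord dimvf leqnn andbT.
  apply/subvP => x _; rewrite [x]e_expand; apply: memv_suml => i _.
  apply: memvZ; apply: memv_span.
  by apply: map_f; rewrite mem_enum.
move=> v /mapP[i _ ->]; exists (f i)%:~R; apply: (can_inj v2rK).
by rewrite -mul_v2r_ad -Dh mul_eD.
Qed.

End AdaptedDerivation.

Lemma exists_semisimple_centralizing (k : closedFieldType)
    (char_k : [pchar k] =i pred0) (s : lieAlgType k) (u : s) :
    lie_simple s -> ~ lie_nilpotent_elt u ->
  exists h, [/\ lie_semisimple_elt h, lie u h = 0 & h != 0].
Proof.
move=> simple_s not_nil; have [P Pu [a aP]] := geigenvector_basis (ad u).
have [a0|/forallPn/= [j aj]] := boolP [forall i, a i == 0].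
  case: not_nil; have [m mP] := fin_all_exists aP.
  (* The largest exponent kills every basis vector at once. *)
  exists (\max_i m i) => v; apply: (can_inj v2rK).
  have -> : v2r (iter (\max_i m i) (lie u) v) = v2r v *m ad u ^+ (\max_i m i).
    elim: (\max_i m i) => [|p IHp]; first by rewrite mulmx1.
    by rewrite iterS -mul_v2r_ad IHp exprSr -mulmxE mulmxA.
  rewrite linear0 -[v2r v](mulmxKV Pu) [_ *m P]mulmx_sum_row mulmx_suml.
  rewrite big1 // => i _.
  have := geigenvector_le (leq_bigmax i) (mP i).
  rewrite (eqP (forallP a0 i)) raddf0 subr0 -scalemxAl => ->.
  exact: scaler0.
have [|f [l fl] fP] := exists_int_additive char_k (a := a); first by exists j.
pose D := invmx P *m diag_mx (\row_i (f i)%:~R) *m P.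
have derD : derivation D := adapted_derivation Pu aP fP.
have trD : \tr (D *m ad u) != 0.
  (* A vanishing trace is a relation with coefficients [f] itself, so [fP] makes the sum of the
     squares of the [f i] zero. *)
  rewrite (adapted_derivation_trace Pu aP fP); apply/eqP => /fP/eqP.
  rewrite psumr_eq0 => [/allP/(_ l)|i _]; last exact: sqr_ge0.
  by rewrite mem_index_enum mulf_eq0 orbb (negPf fl) => /(_ isT).
have [h Dh] := derivation_inner
  (fun x => killing_nondegenerate simple_s derD trD (x := x)) derD.
exists h; split.
- exact: (adapted_semisimple Pu aP fP Dh).
- rewrite lieC; apply: (can_inj v2rK).
  rewrite linearN /= -mul_v2r_ad -Dh (adapted_derivation_centralizes Pu aP fP).
  by rewrite oppr0 linear0.
- by apply: contraNneq trD => h0; rewrite Dh h0 linear0 mul0mx mxtrace0.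
Qed.

(** * The even part of the Takiff superalgebra, identified with [s] *)

Lemma lie_semisimple_isom (k : fieldType) (L M : lieAlgType k)
    (f : {linear L -> M}) (g : M -> L) h :
    cancel f g -> cancel g f -> {morph f : x y / lie x y} ->
  lie_semisimple_elt h -> lie_semisimple_elt (f h).
Proof.
move=> fK gK f_lie [e e_basis e_eigen]; exists [seq linfun f v | v <- e].
  have <- : (linfun f @: fullv)%VS = fullv.
    apply/vspaceP => y; rewrite memvf -[y]gK -(lfunE f).
    exact: memv_img (memvf _).
  apply: limg_basis_of => //; rewrite capfv; apply/eqP/lker0P => x y.
  by rewrite !lfunE => /(can_inj fK).
move=> _ /mapP[v /e_eigen[a hv] ->]; exists a.
by rewrite lfunE -f_lie hv linearZ.
Qed.

Section TakiffEven.
Variables (k : fieldType) (s : lieAlgType k).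

Let g := takiff s.

Definition even_fst (h : even_part g) : s := (vsval h).1.
Definition fst_even (u : s) : even_part g :=
  vsproj (sgrade false) (takiff_ev u).

Lemma val_fst_even u : vsval (fst_even u) = takiff_ev u.
Proof. by rewrite vsprojK //; apply/takiff_evenP; exists u. Qed.

Lemma fst_evenK : cancel fst_even even_fst.
Proof. by move=> u; rewrite /even_fst val_fst_even. Qed.

Lemma val_even h : vsval h = takiff_ev (even_fst h).
Proof. by have /takiff_evenP[u hu] := subvsP h; rewrite /even_fst hu. Qed.

Lemma even_fstK : cancel even_fst fst_even.
Proof. by move=> h; apply: subvs_inj; rewrite val_fst_even -val_even. Qed.

Fact even_fst_is_linear : linear even_fst.
Proof. by move=> a x y; rewrite /even_fst linearP. Qed.
HB.instance Definition _ := GRing.isLinear.Build k (even_part g) s *:%R even_fst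
  even_fst_is_linear.

Fact fst_even_is_linear : linear fst_even.
Proof. exact: can2_linear even_fstK fst_evenK. Qed.
HB.instance Definition _ := GRing.isLinear.Build k s (even_part g) *:%R fst_even
  fst_even_is_linear.

Lemma even_fst_lie : {morph even_fst : x y / lie x y}.
Proof.
move=> x y; rewrite {1}/even_fst even_lieE !val_even.
by have [[-> _ _] _] := takiff_relations (even_fst x) (even_fst y).
Qed.

Lemma fst_even_lie : {morph fst_even : x y / lie x y}.
Proof.
by move=> x y; apply: (can_inj even_fstK); rewrite even_fst_lie !fst_evenK.
Qed.

(** Semisimplicity refers to the adjoint action on the even part on one side and on [s] on the
    other. *)
Lemma semisimple_even_fst h :
  lie_semisimple_elt h <-> lie_semisimple_elt (even_fst h).
Proof.
split; first exact: lie_semisimple_isom even_fstK fst_evenK even_fst_lie.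
move/(lie_semisimple_isom (f := fst_even) fst_evenK even_fstK fst_even_lie).
by rewrite /= even_fstK.
Qed.

(** Even elements commute with [takiff_d s], so [lam] disappears. *)
Lemma slie_even_odd (h : even_part g) lam u :
  slie (vsval h) (lam *: takiff_d s + takiff_xi u)
  = takiff_xi (lie (even_fst h) u).
Proof.
rewrite val_even; congr (_, (_, _)) => /=.
  by rewrite !(scaler0, scale0r, addr0) (linear0 (lie _)).
by rewrite scaler0 add0r lie0l addr0.
Qed.

End TakiffEven.

Theorem lemma7p7p1 (k : closedFieldType) (char_k : [pchar k] =i pred0)
    (s : lieAlgType k) (simple_s : lie_simple s)
    (x : takiff s) (odd_x : x \in sgrade true) :
  sdistinguished x <->
  exists (lam : k) (u : s),
    x = lam *: takiff_d s + takiff_xi u /\ lie_distinguished_nilpotent u.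
Proof.
have commutes (h : even_part (takiff s)) lam u :
    slie (vsval h) (lam *: takiff_d s + takiff_xi u) = 0 <->
    lie u (even_fst h) = 0.
  rewrite slie_even_odd lieC.
  split=> [/(congr1 (fun z => z.2.1)) /= /eqP|->]; last by rewrite oppr0.
  by rewrite oppr_eq0 => /eqP.
split=> [dist_x|[lam [u [-> [_ dist_u]]]] h h_ss /commutes hu]; last first.
  have -> : h = 0.
    rewrite -[h]even_fstK (dist_u (even_fst h)) ?linear0 //.
    exact/semisimple_even_fst.
  move=> y; rewrite linear0; have := slie_linearl y (-1) 0 0.
  by rewrite scaler0 addr0 scaleN1r addNr.
have [u [lam def_x]] := takiff_oddP _ odd_x; exists lam, u.
have {}def_x : x = lam *: takiff_d s + takiff_xi u by rewrite def_x addrC.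
have dist_u h : lie_semisimple_elt h -> lie u h = 0 -> h = 0.
  move=> h_ss uh; apply: lie_simple_center simple_s _ => y.
  (* Centrality in the superalgebra, tested on even elements only, already makes [h] central in
     [s]. *)
  have /(_ (takiff_ev y)) : in_scenter (vsval (fst_even h)).
    apply: dist_x; first by apply/semisimple_even_fst; rewrite fst_evenK.
    by rewrite def_x; apply/commutes; rewrite fst_evenK.
  rewrite val_fst_even; have [[-> _ _] _] := takiff_relations h y.
  by case.
split=> //; split=> //; apply: NNPP => /exists_semisimple_centralizing.
by case=> // h [h_ss uh /eqP[]]; apply: dist_u.
Qed.
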